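(* Let $n\ge3$, let $\mathcal{K}\subseteq\mathbb{R}^n$ be a proper subdual cone, let $A=A^\top\in\mathbb{R}^{n\times n}$, and let $\{v^1,\dots,v^n\}$ be an orthonormal system of eigenvectors of $A$ corresponding to the eigenvalues $\lambda_1,\dots,\lambda_n$, respectively. Assume that $\lambda:=\lambda_1$, $\mu:=\lambda_2=\dots=\lambda_{n-1}$, $\eta:=\lambda_n$ and $$v^1-\sqrt{\frac{\eta-\mu}{\mu-\lambda}}\;|v^n|^{\mathcal{K}}\in\mathcal{K}^*,\qquad \lambda<\mu<\eta.$$ Then the quadratic function $q_A:\mathbb{S}^{n-1}\cap\operatorname{int}(\mathcal{K})\to\mathbb{R}$, $q_A(x)=\langle Ax,x\rangle$, is spherically quasi-convex.
   Context: $\mathbb{S}^{n-1}=\{x\in\mathbb{R}^n:\|x\|=1\}$. A proper cone is a pointed closed convex cone with nonempty interior; $\mathcal{K}^*=\{y:\langle x,y\rangle\ge0\ \forall x\in\mathcal{K}\}$; $\mathcal{K}$ is subdual if $\mathcal{K}\subseteq\mathcal{K}^*$. With $P_{\mathcal{D}}$ the Euclidean projection onto a closed convex cone $\mathcal{D}$, the absolute value of $x$ with respect to $\mathcal{K}$ is $|x|^{\mathcal{K}}:=P_{\mathcal{K}}(x)+P_{\mathcal{K}^*}(-x)$. For $x,y\in\mathbb{S}^{n-1}$ with $y\ne\pm x$ the minimal geodesic from $x$ to $y$ is the constant-speed parametrization $[0,1]\to\mathbb{S}^{n-1}$ of the shorter great-circle arc from $x$ to $y$. A function $f:\mathcal{S}\to\mathbb{R}$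 on $\mathcal{S}=\mathbb{S}^{n-1}\cap\operatorname{int}(\mathcal{K})$ is spherically quasi-convex if for every minimal geodesic segment $\gamma:[0,1]\to\mathcal{S}$ the composition $f\circ\gamma$ is quasi-convex in the usual sense. *)

(* Defs.v *)
From HB Require Import structures.
From mathcomp Require Import all_boot all_order all_algebra.
From mathcomp Require Import all_classical all_reals all_analysis.

Set Implicit Arguments.
Unset Strict Implicit.
Unset Printing Implicit Defensive.

Import Order.TTheory GRing.Theory Num.Theory.
Import numFieldNormedType.Exports.

Local Open Scope classical_set_scope.
Local Open Scope ring_scope.

Section Defs.
Context {R : realType} {n : nat}.
Implicit Types (x y p : 'cV[R]_n) (K D S : set 'cV[R]_n) (f : 'cV[R]_n -> R).

Definition inner x y : R := (x^T *m y) 0 0.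

(* The library norm on matrices is the max norm, hence an explicit Euclidean
   norm; both induce the same topology, so [closed] and [interior] below have
   their usual meaning. *)
Definition enorm x : R := Num.sqrt (inner x x).

Definition unit_sphere : set 'cV[R]_n := [set x | enorm x = 1].

Definition dual_cone K : set 'cV[R]_n :=
  [set y | forall x, K x -> 0 <= inner x y].

Definition is_cone K := forall (t : R) x, 0 < t -> K x -> K (t *: x).

Definition pointed K := K `&` [set x | K (- x)] = [set 0].

Definition proper_cone K :=
  [/\ is_cone K, convex_set K, closed K, pointed K & interior K !=set0].

Definition subdual K := K `<=` dual_cone K.

(* The minimizer exists and is unique when [D] is a nonempty closed convex
   set; [0] is a junk value, returned when there is no minimizer. *)
Definition euclid_proj D x : 'cV[R]_n :=
  xget 0 [set p | D p /\ forall q, D q -> enorm (x - p) <= enorm (x - q)].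

Definition cone_abs K x : 'cV[R]_n := euclid_proj K x + euclid_proj (dual_cone K) (- x).

(* For unit vectors [y <> x] and [y <> - x], the restriction to [0, 1] is the
   constant-speed parametrization of the shorter great-circle arc from [x] to
   [y], whose length is [acos (inner x y)]; it is only meant to be used there. *)
Definition min_geodesic x y (t : R) : 'cV[R]_n :=
  let c := inner x y in
  let theta := acos c in
  let s := Num.sqrt (1 - c ^+ 2) in
  (cos (t * theta) - c * sin (t * theta) / s) *: x
  + (sin (t * theta) / s) *: y.

Definition quasiconvex_on (I : set R) (g : R -> R) :=
  forall s t a : R, I s -> I t -> 0 <= a <= 1 ->
    g (a * s + (1 - a) * t) <= Num.max (g s) (g t).

(* Only the values of [f] on [S] matter. *)
Definition spherically_quasiconvex S f :=
  forall x y, unit_sphere x -> unit_sphere y -> y <> x -> y <> - x ->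
    (forall t : R, `[0, 1]%classic t -> S (min_geodesic x y t)) ->
    quasiconvex_on `[0, 1]%classic (f \o min_geodesic x y).

Definition quad_form (A : 'M[R]_n) x : R := inner (A *m x) x.

End Defs.

(* Main.v *)
Require Import Defs.
From mathcomp Require Import all_boot all_order all_algebra.
From mathcomp Require Import all_classical all_reals all_analysis.
From mathcomp Require Import ring lra.

Import Order.TTheory GRing.Theory Num.Theory.
Import numFieldNormedType.Exports.

Local Open Scope classical_set_scope.
Local Open Scope ring_scope.

(** Quasi-convexity says that the sublevel sets of the quadratic form are
    stable under nonnegative combinations inside the cone.  Expand in the
    eigenbasis and write [a] and [b] for the coordinates of [x] along [v i1] and
    [v iN].  For unit [x],
    [quad_form A x - mu = (eta - mu) * b ^+ 2 - (mu - lambda) * a ^+ 2].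

    Moreau's decomposition [y = P_K(y) - P_K*(-y)], together with
    subduality, gives [`|<y, x>| <= <|y|^K, x>] for every [x] in [K]
    ([abs_inner_le_cone_abs]).  Pairing the hypothesis on the cone absolute value
    of [v iN] with [x] therefore yields [a >= s * `|b|], where
    [s ^+ 2 = (eta - mu) / (mu - lambda)].  This has two consequences on the
    cone: the form never exceeds [mu], and [a] is positive wherever the form is
    smaller than [mu].

    Let [c] be the larger of the values of the form at two points of the
    sphere inside [K].  If [c >= mu], the first consequence already bounds the
    form at every point in between.  If [c < mu], then [A - c] is nonnegative in
    every eigendirection except that of [v i1], so its nonpositive set is a
    Lorentz cone with axis [v i1], and by the second consequence both points
    lie in the same nappe.  The reversed Cauchy-Schwarz inequality
    ([timelike_form_le0]) then makes the bilinear form of [A - c] nonpositive on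
    the pair, hence the quadratic form is nonpositive on the points in between,
    which are nonnegative combinations of the two up to a positive factor
    ([geodesic_between]). *)

Set Implicit Arguments.
Unset Strict Implicit.

(** * The Euclidean inner product *)

Section Inner.
Context {R : realType} {n : nat}.
Implicit Types (x y z : 'cV[R]_n) (K D : set 'cV[R]_n).

Lemma innerE x y : inner x y = \sum_i x i 0 * y i 0.
Proof. by rewrite /inner mxE; apply: eq_bigr => i _; rewrite mxE. Qed.

Lemma innerC x y : inner x y = inner y x.
Proof. by rewrite !innerE; apply: eq_bigr => i _; rewrite mulrC. Qed.

Lemma innerDr x y z : inner x (y + z) = inner x y + inner x z.
Proof. by rewrite /inner mulmxDr mxE. Qed.

Lemma innerNr x y : inner x (- y) = - inner x y.
Proof. by rewrite /inner mulmxN mxE. Qed.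

Lemma innerZr (a : R) x y : inner x (a *: y) = a * inner x y.
Proof. by rewrite /inner -scalemxAr mxE. Qed.

Lemma innerDl x y z : inner (x + y) z = inner x z + inner y z.
Proof. by rewrite !(innerC _ z) innerDr. Qed.

Lemma innerNl x y : inner (- x) y = - inner x y.
Proof. by rewrite !(innerC _ y) innerNr. Qed.

Lemma innerZl (a : R) x y : inner (a *: x) y = a * inner x y.
Proof. by rewrite !(innerC _ y) innerZr. Qed.

Definition inner_lin := (innerDl, innerDr, innerNl, innerNr, innerZl, innerZr).

Lemma inner_ge0 x : 0 <= inner x x.
Proof. by rewrite innerE sumr_ge0 // => i _; rewrite -expr2 sqr_ge0. Qed.

Lemma sqr_coord_le_inner x i : x i 0 ^+ 2 <= inner x x.
Proof.
rewrite innerE (bigD1 i) //= -expr2 lerDl sumr_ge0 // => j _.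
by rewrite -expr2 sqr_ge0.
Qed.

Lemma inner_eq0 x : inner x x = 0 -> x = 0.
Proof.
move=> x0; apply/colP => i; rewrite mxE; apply/eqP.
by rewrite -sqrf_eq0 eq_le sqr_ge0 andbT -x0 sqr_coord_le_inner.
Qed.

Lemma enorm_le x y : (enorm x <= enorm y) = (inner x x <= inner y y).
Proof. by rewrite /enorm ler_sqrt // inner_ge0. Qed.

Lemma unit_sphereP x : unit_sphere x <-> inner x x = 1.
Proof.
rewrite /unit_sphere /= /enorm; split=> [h|->]; last by rewrite sqrtr1.
by rewrite -(sqr_sqrtr (inner_ge0 x)) h expr1n.
Qed.

Lemma inner_continuous y : continuous (fun x => inner (y - x) (y - x)).
Proof.
rewrite (_ : (fun x => _) = fun x => \sum_i (y i 0 - x i 0) * (y i 0 - x i 0)).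
  have add2 : continuous (fun z : R * R => z.1 + z.2).
    by move=> z; exact: add_continuous.
  have coordB i : continuous (fun x : 'cV[R]_n => y i 0 - x i 0).
    by move=> x; apply: continuousB; [exact: cst_continuous|exact: coord_continuous].
  apply: (continuous_big add2) => i _ x.
  exact: (continuousM (coordB i x) (coordB i x)).
by apply/funext => x; rewrite innerE; apply: eq_bigr => i _; rewrite !mxE.
Qed.

(** * Metric projection onto a closed set *)

Lemma trmx_continuous (p q : nat) : continuous (@trmx R p q).
Proof.
move=> u A /nbhs_ballP[e /= e0 eA]; apply/nbhs_ballP; exists e => //= v [_ uv].
by apply: eA; split=> // i j; rewrite !mxE; apply: uv.
Qed.

(** A box of columns is the transpose of a box of rows, and the latter is a
    product of segments. *)
Lemma box_compact (a b : 'I_n -> R) :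
  compact [set x : 'cV[R]_n | forall i, a i <= x i 0 <= b i].
Proof.
have rc : compact [set r : 'rV[R]_n | forall i, `[a i, b i]%classic (r ord0 i)].
  apply: (@rV_compact _ _ (fun i => `[a i, b i]%classic)) => i.
  exact: segment_compact.
rewrite (_ : mkset _ =
  trmx @` [set r : 'rV[R]_n | forall i, `[a i, b i]%classic (r ord0 i)]).
  apply: continuous_compact rc; apply: continuous_subspaceT.
  by move=> r; exact: trmx_continuous.
apply/seteqP; split=> x /=.
  move=> hx; exists x^T; last by rewrite trmxK.
  by move=> i /=; rewrite mxE in_itv /= hx.
by move=> [r hr <-] i; rewrite mxE; have := hr i; rewrite /= in_itv.
Qed.

(** Minimizing over [D] amounts to minimizing over the points at least as near
    to [x] as [q0]; these form a closed subset of a box, hence a compact set. *)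
Lemma exists_nearest D x q0 : closed D -> D q0 ->
  exists p, D p /\ forall q, D q -> enorm (x - p) <= enorm (x - q).
Proof.
move=> cD Dq0; pose M := enorm (x - q0).
pose B := D `&` [set q | inner (x - q) (x - q) <= inner (x - q0) (x - q0)].
have clB : closed B.
  apply: closedI => //.
  exact: ((continuous_closedP _).1 (@inner_continuous x) _
    (@closed_le R (inner (x - q0) (x - q0)))).
have cB : compact B.
  apply: (subclosed_compact clB
    (@box_compact (fun i => x i 0 - M) (fun i => x i 0 + M))).
  move=> q [_ /= qle] i; rewrite -ler_distlC.
  rewrite -(ler_pXn2r (n := 2)) ?nnegrE ?sqrtr_ge0 // real_normK ?num_real //.
  rewrite sqr_sqrtr ?inner_ge0 //; apply: le_trans qle.
  by have := sqr_coord_le_inner (x - q) i; rewrite !mxE.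
have B0 : B !=set0 by exists q0; split => /=.
have [p /set_mem[Dp pq0] pmin] := compact_EVT_min B0 cB
  (continuous_subspaceT (@inner_continuous x)).
exists p; split=> // q Dq; rewrite enorm_le.
have [qle|/ltW qge] := leP (inner (x - q) (x - q)) (inner (x - q0) (x - q0)).
  by apply: pmin; apply/mem_set; split.
exact: le_trans pq0 qge.
Qed.

Lemma euclid_proj_nearest D x q0 : closed D -> D q0 ->
  D (euclid_proj D x) /\
  forall q, D q -> enorm (x - euclid_proj D x) <= enorm (x - q).
Proof.
move=> cD Dq0; have [p hp] := exists_nearest x cD Dq0.
rewrite /euclid_proj; case: xgetP => [y _ //|].
by move=> /(_ p); case.
Qed.

(** The obtuse-angle criterion forces the minimizer to be [p], because
    [|x - q|^2 >= |x - p|^2 + |q - p|^2] on [D]. *)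
Lemma euclid_proj_eq D x p : D p ->
  (forall q, D q -> inner (x - p) (q - p) <= 0) -> euclid_proj D x = p.
Proof.
move=> Dp obtuse; rewrite /euclid_proj; case: xgetP => [y _ [Dy ymin]|].
  have := ymin p Dp; rewrite enorm_le => h; have := obtuse y Dy => o.
  apply/eqP; rewrite -subr_eq0; apply/eqP/inner_eq0/eqP.
  rewrite eq_le inner_ge0 andbT.
  have e : x - y = (x - p) - (y - p) by rewrite opprB addrA subrK.
  move: h o; rewrite e; move: (y - p) (x - p) => u w.
  rewrite !inner_lin (innerC u w); lra.
move=> /(_ p); case; split=> // q Dq; rewrite enorm_le.
have -> : x - q = (x - p) - (q - p) by rewrite opprB addrA subrK.
have := obtuse q Dq; have := inner_ge0 (q - p).
move: (q - p) (x - p) => u w; rewrite !inner_lin (innerC u w); lra.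
Qed.

(** * Moreau's decomposition and the cone absolute value *)

(** First-order optimality condition: a small enough step makes the quadratic
    term negligible. *)
Lemma linear_term_le0 (b c : R) : 0 <= c ->
  (forall t : R, 0 < t < 1 -> 2 * t * b <= t ^+ 2 * c) -> b <= 0.
Proof.
move=> c0 h; rewrite leNgt; apply/negP => b0.
have d0 : 0 < b + c + 1 by lra.
have [t [t01 tc]] : exists t : R, 0 < t < 1 /\ t * c < b.
  (* The step must be below 1 and, if c is positive, below b / c; the term 1 in
     the denominator makes both inequalities strict. *)
  exists (b / (b + c + 1)); rewrite divr_gt0 //= ltr_pdivrMr //.
  by rewrite mulrAC ltr_pdivrMr // ltr_pM2l //; split; lra.
have t0 : 0 < t by case/andP: t01.
have := h t t01; rewrite expr2 -!mulrA (mulrCA 2) ler_pM2l //; lra.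
Qed.

(** [x + y] is twice a midpoint. *)
Lemma cone_addr K x y : is_cone K -> convex_set K -> K x -> K y -> K (x + y).
Proof.
move=> cK vK Kx Ky.
have h2 : 0 <= (2^-1 : R) <= 1 by lra.
have : K (2^-1 *: x + (1 - 2^-1) *: y).
  apply: set_mem; case/andP: h2 => h0 h1.
  exact: (vK x y (Itv01 h0 h1) (mem_set Kx) (mem_set Ky)).
move/(cK 2 _ (ltr0Sn _ _)); congr (K _); rewrite scalerDr !scalerA.
have -> : 2 * 2^-1 = 1 :> R by lra.
have -> : 2 * (1 - 2^-1) = 1 :> R by lra.
by rewrite !scale1r.
Qed.

(** The nearest point [p] can be perturbed inside [K] by any [q] in [K], and by
    [- p] for steps smaller than 1.  Hence [x - p] is polar to [K] and orthogonal
    to [p], which is the obtuse-angle criterion for [p - x] to be the projection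
    of [- x] onto the dual cone. *)
Lemma moreau K x : is_cone K -> convex_set K -> closed K -> K 0 ->
  [/\ K (euclid_proj K x), dual_cone K (euclid_proj K x - x) &
      euclid_proj (dual_cone K) (- x) = euclid_proj K x - x].
Proof.
move=> cK vK clK K0.
have [Kp pmin] := euclid_proj_nearest x clK K0.
move: (euclid_proj K x) Kp pmin => p Kp pmin.
have step u : (forall t, 0 < t < 1 -> K (p + t *: u)) -> inner (x - p) u <= 0.
  move=> Ku; apply: (linear_term_le0 (inner_ge0 u)) => t t01.
  have := pmin _ (Ku t t01); rewrite enorm_le opprD addrA.
  move: (x - p) => w; rewrite !inner_lin (innerC u w); lra.
have polar q : K q -> inner (x - p) q <= 0.
  move=> Kq; apply: step => t /andP[t0 _].
  by apply: cone_addr => //; apply: cK.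
have ortho : inner (x - p) p = 0.
  apply/eqP; rewrite eq_le polar //=.
  rewrite -oppr_le0 -innerNr; apply: step => t t01.
  rewrite scalerN -{1}(scale1r p) -scalerBl; apply: cK => //; lra.
have Kd : dual_cone K (p - x).
  by move=> q /polar; rewrite -opprB innerNl innerC; lra.
split=> //; apply: euclid_proj_eq => // q Kq.
have -> : - x - (p - x) = - p by rewrite opprB addrCA addrA subrr add0r.
have := Kq p Kp; move: ortho.
rewrite !inner_lin (innerC x p); lra.
Qed.

(** With [p] and [d] the projections of [y] and [- y] onto [K] and its dual,
    [<y, x> = <p, x> - <d, x>] while the cone absolute value pairs to
    [<p, x> + <d, x>]; both terms are nonnegative, the first one by subduality. *)
Lemma abs_inner_le_cone_abs K x y : proper_cone K -> subdual K -> K x ->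
  `|inner y x| <= inner (cone_abs K y) x.
Proof.
move=> [cK vK clK pK _] sK Kx.
have K0 : K 0 by have : [set (0 : 'cV[R]_n)] 0 by []; rewrite -pK => -[].
have [Kp Kd e] := moreau y cK vK clK K0.
rewrite /cone_abs e; have := sK _ Kp x Kx; have := Kd x Kx.
move: (euclid_proj K y) => p; rewrite ler_norml !inner_lin !(innerC x).
by move=> *; apply/andP; split; lra.
Qed.

(** * Eigenbasis expansions *)

Lemma inner_orthobasis (v : 'I_n -> 'cV[R]_n) :
  (forall i j, inner (v i) (v j) = (i == j)%:R) ->
  forall x y, inner x y = \sum_i inner (v i) x * inner (v i) y.
Proof.
move=> orth x y; pose V := \matrix_(i, j) v j i 0.
have VV : V *m V^T = 1%:M.
  (* Orthonormality is V^T V = 1; for a square matrix this gives V V^T = 1. *)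
  apply: mulmx1C; apply/matrixP => i j; rewrite !mxE -orth innerE.
  by apply: eq_bigr => k _; rewrite !mxE.
have coord z i : (V^T *m z) i 0 = inner (v i) z.
  by rewrite mxE innerE; apply: eq_bigr => k _; rewrite !mxE.
rewrite [LHS]/inner -[y in LHS]mul1mx -VV -mulmxA mulmxA mxE.
apply: eq_bigr => i _; rewrite coord; congr (_ * _).
by rewrite -coord !mxE; apply: eq_bigr => k _; rewrite !mxE mulrC.
Qed.

Lemma form_eigenbasis (A : 'M[R]_n) (v : 'I_n -> 'cV[R]_n) (lam : 'I_n -> R) :
  A = A^T -> (forall i j, inner (v i) (v j) = (i == j)%:R) ->
  (forall i, A *m v i = lam i *: v i) ->
  forall x y, inner (A *m x) y = \sum_i lam i * (inner (v i) x * inner (v i) y).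
Proof.
move=> sA orth eig x y; rewrite (inner_orthobasis orth).
apply: eq_bigr => i _; rewrite mulrA; congr (_ * _).
by rewrite -innerZl -eig /inner trmx_mul -sA mulmxA.
Qed.

(** * Points between two points of a geodesic *)

(** Three vectors of a plane satisfy one linear relation; on a great circle its
    coefficients are the sines of the angles between the other two.
    Both coordinates of the relation, along [x] and [y], follow from the addition
    formulas. *)
Lemma geodesic_between x y (s m t : R) :
  let th := acos (inner x y) in
  sin ((t - s) * th) *: min_geodesic x y m =
  sin ((t - m) * th) *: min_geodesic x y s +
  sin ((m - s) * th) *: min_geodesic x y t.
Proof.
rewrite /min_geodesic /=; set th := acos _; set S := Num.sqrt _.
set c := inner x y.
have cos_between : sin ((t - s) * th) * cos (m * th) =
  sin ((t - m) * th) * cos (s * th) + sin ((m - s) * th) * cos (t * th).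
  by rewrite !mulrBl !sinB; ring.
have sin_between : sin ((t - s) * th) * sin (m * th) =
  sin ((t - m) * th) * sin (s * th) + sin ((m - s) * th) * sin (t * th).
  by rewrite !mulrBl !sinB; ring.
rewrite !scalerDr !scalerA addrACA -!scalerDl; congr (_ *: _ + _ *: _).
  rewrite !mulrBr cos_between !mulrA !(mulrAC _ c) sin_between; ring.
by rewrite !mulrA sin_between; ring.
Qed.

Lemma inner_unit_gtN1_lt1 x y : unit_sphere x -> unit_sphere y ->
  y <> x -> y <> - x -> -1 < inner x y < 1.
Proof.
move=> /unit_sphereP xx /unit_sphereP yy neq opp.
have pos z : z <> 0 -> 0 < inner z z.
  move=> z0; rewrite lt_neqAle inner_ge0 andbT eq_sym.
  by apply/eqP => /inner_eq0.
have : 0 < inner (y - x) (y - x).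
  by apply: pos => /eqP; rewrite subr_eq0 => /eqP.
have : 0 < inner (y + x) (y + x).
  by apply: pos => /eqP; rewrite addr_eq0 => /eqP.
by rewrite !inner_lin xx yy (innerC y x) => *; apply/andP; split; lra.
Qed.

End Inner.

Lemma quasiconvex_on_ordered {R : realType} (I : set R) (g : R -> R) :
  (forall s m t, I s -> I t -> s < t -> s <= m <= t ->
     g m <= Num.max (g s) (g t)) -> quasiconvex_on I g.
Proof.
move=> h s t a Is It a01; have [st|ts|->] := ltgtP s t.
- by apply: h => //; nra.
- by rewrite maxC; apply: h => //; nra.
by rewrite -mulrDl addrC subrK mul1r maxxx.
Qed.

(** Quasi-convexity along geodesics only has to be tested on triples of points
    linked by a nonnegative linear relation: for unit vectors that are neither
    equal nor opposite the arc is strictly between 0 and [pi], where the sines of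
    [geodesic_between] have the right signs. *)
Lemma spherically_quasiconvex_of_combinations {R : realType} {n : nat} (S : set 'cV[R]_n) f :
  (forall x y z (sg al be : R), S x -> S y -> S z -> 0 < sg -> 0 <= al -> 0 <= be ->
     sg *: z = al *: x + be *: y -> f z <= Num.max (f x) (f y)) ->
  spherically_quasiconvex S f.
Proof.
move=> h x y Ux Uy neq opp Sg.
have /andP[c1 c2] := inner_unit_gtN1_lt1 Ux Uy neq opp.
apply: quasiconvex_on_ordered => s m t Is It st /andP[sm mt] /=.
have := Is; have := It; rewrite /= !in_itv /= => /andP[t0 t1] /andP[s0 s1].
have th0 : 0 < acos (inner x y) by apply: acos_gt0; rewrite c2 ltW.
have thpi : acos (inner x y) < pi by apply: acos_ltpi; rewrite c1 ltW.
have Im : `[0, 1]%classic m by rewrite /= in_itv /=; lra.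
apply: h (Sg s Is) (Sg t It) (Sg m Im) _ _ _ (geodesic_between x y s m t).
- by apply: sin_gt0_pi; apply/andP; split; nra.
- by apply: sin_ge0_pi; apply/andP; split; nra.
- by apply: sin_ge0_pi; apply/andP; split; nra.
Qed.

(** * Quasi-convexity of the quadratic form *)

(** Reversed Cauchy-Schwarz inequality for a form with a single possibly negative
    direction [i1].  Its value at [Y i1 *: X - X i1 *: Y], whose [i1] coordinate
    vanishes, is nonnegative; since the two square terms of the expansion are
    nonpositive, the cross term must compensate them. *)
Lemma timelike_form_le0 {R : realType} {I : finType} (d X Y : I -> R) i1 :
  (forall i, i != i1 -> 0 <= d i) -> 0 < X i1 -> 0 < Y i1 ->
  \sum_i d i * (X i * X i) <= 0 -> \sum_i d i * (Y i * Y i) <= 0 ->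
  \sum_i d i * (X i * Y i) <= 0.
Proof.
move=> d0 X0 Y0 XX YY.
have : 0 <= \sum_i d i * (Y i1 * X i - X i1 * Y i) ^+ 2.
  apply: sumr_ge0 => i _; have [->|/d0 di] := eqVneq i i1.
    by rewrite (mulrC (Y i1)) subrr expr0n mulr0.
  by rewrite mulr_ge0 // sqr_ge0.
rewrite (_ : \sum_i _ = Y i1 ^+ 2 * (\sum_i d i * (X i * X i))
  + X i1 ^+ 2 * (\sum_i d i * (Y i * Y i))
  - (X i1 * Y i1) *+ 2 * (\sum_i d i * (X i * Y i))); last first.
  rewrite !mulr_sumr -sumrN -!big_split /=.
  by apply: eq_bigr => i _; ring.
move=> h; rewrite -(pmulr_rle0 _ (_ : 0 < (X i1 * Y i1) *+ 2)); last first.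
  by rewrite pmulrn_rgt0 // mulr_gt0.
have : Y i1 ^+ 2 * (\sum_i d i * (X i * X i)) <= 0.
  by rewrite mulr_ge0_le0 // sqr_ge0.
have : X i1 ^+ 2 * (\sum_i d i * (Y i * Y i)) <= 0.
  by rewrite mulr_ge0_le0 // sqr_ge0.
lra.
Qed.

Unset Implicit Arguments.
Set Strict Implicit.

Theorem theorem5p4p2 (R : realType) (n : nat) (K : set 'cV[R]_n)
    (A : 'M[R]_n) (v : 'I_n -> 'cV[R]_n) (lam : 'I_n -> R)
    (i1 iN : 'I_n) (lambda mu eta : R)
    (hn : (3 <= n)%N)
    (hK : proper_cone K) (hsub : subdual K)
    (hA : A = A^T)
    (horth : forall i j : 'I_n, inner (v i) (v j) = (i == j)%:R)
    (heig : forall i : 'I_n, A *m v i = lam i *: v i)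
    (hi1 : nat_of_ord i1 = 0%N) (hiN : nat_of_ord iN = n.-1)
    (hlambda : lam i1 = lambda)
    (hmu : forall i : 'I_n, i != i1 -> i != iN -> lam i = mu)
    (heta : lam iN = eta)
    (hlt : lambda < mu < eta)
    (habs : dual_cone K
      (v i1 - Num.sqrt ((eta - mu) / (mu - lambda)) *: cone_abs K (v iN))) :
  spherically_quasiconvex (unit_sphere `&` interior K) (quad_form A).
Proof.
move: hlt => /andP[lt1 lt2].
have i1N : iN != i1.
  by apply/eqP => e; move: hiN; rewrite e hi1; case: (n) hn => [|[|k]].
have form c x y : inner (A *m x) y - c * inner x y =
    \sum_i (lam i - c) * (inner (v i) x * inner (v i) y).
  rewrite (form_eigenbasis hA horth heig) (inner_orthobasis horth) mulr_sumr.
  by rewrite -sumrB; apply: eq_bigr => i _; rewrite mulrBl.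
have gap x : quad_form A x - mu * inner x x =
    (lambda - mu) * inner (v i1) x ^+ 2 + (eta - mu) * inner (v iN) x ^+ 2.
  rewrite form (bigD1 i1) // (bigD1 iN) //= big1 ?addr0 ?hlambda ?heta ?expr2 //.
  by move=> i /andP[ne1 neN]; rewrite hmu // subrr mul0r.
have axis x : K x -> 0 <= inner (v i1) x /\
    (eta - mu) * inner (v iN) x ^+ 2 <= (mu - lambda) * inner (v i1) x ^+ 2.
  move=> Kx; have absle := abs_inner_le_cone_abs (v iN) hK hsub Kx.
  have := habs x Kx; rewrite innerC; set s := Num.sqrt _.
  have s0 : 0 <= s by exact: sqrtr_ge0.
  have s2 : s ^+ 2 * (mu - lambda) = eta - mu.
    rewrite sqr_sqrtr ?divr_ge0 ?subr_ge0 ?ltW // divfK //.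
    by rewrite subr_eq0 gt_eqF.
  rewrite innerDl innerNl innerZl subr_ge0 => sle.
  have {sle} : s * `|inner (v iN) x| <= inner (v i1) x.
    by apply: le_trans sle; apply: ler_wpM2l.
  move: (inner (v i1) x) (inner (v iN) x) => a b sb.
  have sb0 : 0 <= s * `|b| by rewrite mulr_ge0.
  have a0 := le_trans sb0 sb; split=> //.
  rewrite -s2 -(real_normK (num_real b)) mulrAC -exprMn mulrC ler_pM2l ?subr_gt0 //.
  by rewrite ler_pXn2r ?nnegrE.
apply: spherically_quasiconvex_of_combinations => x y z sg al be.
move=> [/unit_sphereP xx /interior_subset Kx].
move=> [/unit_sphereP yy /interior_subset Ky].
move=> [/unit_sphereP zz /interior_subset Kz] sg0 al0 be0 comb.
set c := Num.max _ _.
have xc : quad_form A x <= c by rewrite le_max lexx.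
have yc : quad_form A y <= c by rewrite le_max lexx orbT.
(* Above the level mu there is nothing to compare: the form is at most mu on K. *)
have [muc|cmu] := leP mu c.
  apply: le_trans muc; rewrite -subr_le0 -[mu]mulr1 -zz gap.
  have [_] := axis z Kz; lra.
have pos w : K w -> inner w w = 1 -> quad_form A w <= c -> 0 < inner (v i1) w.
  move=> Kw ww wc; have [a0 _] := axis w Kw.
  rewrite lt_neqAle a0 andbT eq_sym; apply/eqP => a00.
  have := gap w; rewrite ww a00 expr0n mulr0 add0r.
  have := mulr_ge0 (ltW (etrans (subr_gt0 _ _) lt2)) (sqr_ge0 (inner (v iN) w)); lra.
pose B u w := inner (A *m u) w - c * inner u w.
have Bxx : B x x <= 0 by rewrite /B xx mulr1 subr_le0.
have Byy : B y y <= 0 by rewrite /B yy mulr1 subr_le0.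
have Bxy : B x y <= 0.
  move: Bxx Byy; rewrite /B !form.
  apply: (timelike_form_le0 (i1 := i1) _ (pos x Kx xx xc) (pos y Ky yy yc)).
  move=> i ne1; have [->|neN] := eqVneq i iN; first by rewrite heta; lra.
  by rewrite hmu //; lra.
have Byx : B y x = B x y.
  by rewrite /B !form; apply: eq_bigr => i _; rewrite (mulrC (inner (v i) y)).
have : B (sg *: z) (sg *: z) <= 0.
  have -> : B (sg *: z) (sg *: z) =
      al ^+ 2 * B x x + (al * be) *+ 2 * B x y + be ^+ 2 * B y y.
    rewrite comb mulr2n mulrDl -{2}Byx /B !mulmxDr -!scalemxAr !inner_lin; ring.
  have := mulr_ge0_le0 (sqr_ge0 al) Bxx.
  have := mulr_ge0_le0 (sqr_ge0 be) Byy.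
  have := mulr_ge0_le0 (mulrn_wge0 2 (mulr_ge0 al0 be0)) Bxy; lra.
rewrite /B -scalemxAr !inner_lin zz mulr1.
rewrite (_ : _ - _ = sg ^+ 2 * (quad_form A z - c)); last by rewrite /quad_form; ring.
by rewrite pmulr_rle0 ?exprn_gt0 // subr_le0.
Qed.
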